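(* Let $M=US$ be a $(U,S)$-proper monoid, where $U$ and $S$ are submonoids, with $U$ a left-regular band. Then there exist a monoid $\mathcal U_L$, a semidirect product $\mathcal M=\mathcal U_L\rtimes(S/\sigma)$ and an embedding $\psi:M\to\mathcal M$ such that: (i) $\mathcal U_L$ is a left-regular band; (ii) $\mathcal U_L$ contains a subsemigroup $U'$ isomorphic to $U$; (iii) $\psi|_U:U\to U'\times\{\widehat 1\}$ (the subsemigroup $U'\rtimes\{\widehat1\}$ of $\mathcal M$) is an isomorphism.
   Context: A left-regular band is a semigroup satisfying $x^2=x$ and $xyx=xy$ for all $x,y$. For a subsemigroup $U$ of a monoid $M$ with identity $1$, $U^1=U\cup\{1\}$. An action pair in $M$ is a pair $(U,S)$ of subsemigroups of $M$ together with a left action $(s,u)\mapsto{}^su$ of $S$ on $U^1$ by semigroup morphisms (${}^s({}^tu)={}^{st}u$, ${}^s(uv)={}^su\cdot{}^sv$) such that (A1) $s\cdot u={}^su\cdot s$ for all $s\in S,u\in U^1$, and (A2) $us=vt\Rightarrow u\cdot{}^s1=v\cdot{}^t1$ for all $u,v\in U^1$, $s,t\in S$. Write $s^+={}^s1$, $S^+=\{s^+:s\in S\}$, and let $P=\langle S^+\rangle$ be the subsemigroup of $U^1$ generated by $S^+$. Let $\kappa=\{(s,t)\in S\times S:ps=qt\text{ for some }p,q\in P\}$ and let $\sigma=\kappa^\sharp$ be the congruence on $S$ generated by $\kappa$. The $\sigma$-class of $s\in S$ is denoted $\widehat s$. The pair $(U,S)$ is proper if for all $u,v\in U^1$, $s,t\in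 S$: $us=vt\iff us^+=vt^+$ and $s\mathrel\sigma t$. ''$M=US$ is a $(U,S)$-proper monoid'' means: $(U,S)$ is a proper action pair in the monoid $M$, $U$ and $S$ are both submonoids of $M$, and $M=US=\{us:u\in U,s\in S\}$. A semidirect product $\mathcal U\rtimes T$ of a monoid $\mathcal U$ and a semigroup $T$ is formed from a left action of $T$ on $\mathcal U$ by semigroup morphisms, with product $(u,s)(v,t)=(u\cdot{}^sv,st)$ on the set $\mathcal U\times T$. An embedding is an injective semigroup morphism. *)

(* Defs.v *)
From HB Require Import structures.
From mathcomp Require Import all_boot all_classical.

Set Implicit Arguments.
Unset Strict Implicit.
Unset Printing Implicit Defensive.

Local Open Scope classical_set_scope.
Local Open Scope quotient_scope.
Local Open Scope group_scope.

(* Subsemigroups and submonoids of M are the library's [mulgClosed M] and     *)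
(* [umagmaClosed M]; these are boolean predicates, but in the presence of     *)
(* boolp every subset of M has a boolean characteristic function.             *)

Definition left_regular_band (T : semigroupType) : Prop :=
  (forall x : T, x * x = x) /\ (forall x y : T, x * y * x = x * y).

Definition sub_sg (M : semigroupType) (A : mulgClosed M) : Type :=
  {x : M | x \in A}.

Section SubSemigroup.
Variables (M : semigroupType) (A : mulgClosed M).
HB.instance Definition _ := SubChoice.copy (sub_sg A) {x : M | x \in A}.
HB.instance Definition _ :=
  SubChoice_isSubSemigroup.Build M (fun x => x \in A) (sub_sg A) (@gpredM M A).
End SubSemigroup.

Section SubMonoid.
Variables (M : monoidType) (A : umagmaClosed M).

Definition sub_one : sub_sg A := exist _ 1 (@gpred1 M A).

Fact sub_mul1g : left_id sub_one *%g.
Proof. by move=> x; apply/val_inj; rewrite valM /= mul1g. Qed.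

Fact sub_mulg1 : right_id sub_one *%g.
Proof. by move=> x; apply/val_inj; rewrite valM /= mulg1. Qed.

HB.instance Definition _ :=
  Magma_isUMagma.Build (sub_sg A) sub_mul1g sub_mulg1.
End SubMonoid.

Definition adjoin1 (M : monoidType) (U : mulgClosed M) : {pred M} :=
  fun x => (x == 1) || (x \in U).

Section Adjoin1.
Variables (M : monoidType) (U : mulgClosed M).

Fact adjoin1_1 : 1 \in adjoin1 U.
Proof. by rewrite unfold_in /adjoin1 eqxx. Qed.

Fact adjoin1_M : mulg_closed (adjoin1 U).
Proof.
move=> x y; rewrite !unfold_in /adjoin1.
case/predU1P=> [->|Ux]; first by rewrite mul1g.
case/predU1P=> [->|Uy]; first by rewrite mulg1 Ux orbT.
by apply/orP; right; apply: gpredM.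
Qed.

HB.instance Definition _ := isMulClosed.Build M (adjoin1 U) adjoin1_M.
HB.instance Definition _ := isMul1Closed.Build M (adjoin1 U) adjoin1_1.
End Adjoin1.

Notation "U ^1" := (sub_sg (adjoin1 U))
  (at level 1, left associativity, format "U ^1") : type_scope.

(* The identity of T, if any, is not required to act as the identity of A,    *)
(* and the morphisms are not required to preserve an identity of A.           *)
Record left_action (T A : semigroupType) := LeftAction {
  act :> T -> A -> A;
  actA : forall s t u, act s (act t u) = act (s * t) u;
  actM : forall s u v, act s (u * v) = act s u * act s v
}.

Definition sdprod (A : monoidType) (T : semigroupType)
  (alpha : left_action T A) : Type := (A * T)%type.

Section Semidirect.
Variables (A : monoidType) (T : semigroupType) (alpha : left_action T A).

Definition sdmul (x y : sdprod alpha) : sdprod alpha :=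
  (x.1 * alpha x.2 y.1, x.2 * y.2).

Fact sdmulA : associative sdmul.
Proof. by move=> x y z; rewrite /sdmul /= !actM actA !mulgA. Qed.

HB.instance Definition _ := Choice.copy (sdprod alpha) (A * T)%type.
HB.instance Definition _ := isSemigroup.Build (sdprod alpha) sdmulA.
End Semidirect.

Inductive generated_sg (T : semigroupType) (X : set T) : set T :=
| generated_sg_in x : X x -> generated_sg X x
| generated_sg_mul x y :
    generated_sg X x -> generated_sg X y -> generated_sg X (x * y).

Definition is_congruence (T : semigroupType) (C : T -> T -> Prop) : Prop :=
  [/\ forall x, C x x,
      forall x y, C x y -> C y x,
      forall x y z, C x y -> C y z -> C x z,
      forall z x y, C x y -> C (z * x) (z * y)
    & forall z x y, C x y -> C (x * z) (y * z)].

Definition generated_cong (T : semigroupType) (R : T -> T -> Prop) (x y : T) :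
    Prop :=
  forall C, is_congruence C -> (forall a b, R a b -> C a b) -> C x y.

Section Quotient.
Variables (T : semigroupType) (R : T -> T -> Prop).

Lemma generated_congP : is_congruence (generated_cong R).
Proof.
split.
- by move=> x C [].
- move=> x y xy C CC RC; have [_ Cs _ _ _] := CC; exact: Cs (xy C CC RC).
- move=> x y z xy yz C CC RC; have [_ _ Ct _ _] := CC.
  exact: Ct (xy C CC RC) (yz C CC RC).
- move=> z x y xy C CC RC; have [_ _ _ Cl _] := CC; exact: Cl (xy C CC RC).
- move=> z x y xy C CC RC; have [_ _ _ _ Cr] := CC; exact: Cr (xy C CC RC).
Qed.

Definition gcong (x y : T) : bool := `[< generated_cong R x y >].

Lemma gcongP x y : reflect (generated_cong R x y) (gcong x y).
Proof. exact: asboolP. Qed.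

Fact gcong_refl : reflexive gcong.
Proof.
have [Cx _ _ _ _] := generated_congP.
by move=> x; apply/gcongP; exact: Cx.
Qed.

Fact gcong_sym : symmetric gcong.
Proof.
have [_ Cs _ _ _] := generated_congP.
by move=> x y; apply/gcongP/gcongP; [exact: (Cs x y) | exact: (Cs y x)].
Qed.

Fact gcong_trans : transitive gcong.
Proof.
have [_ _ Ct _ _] := generated_congP.
by move=> y x z /gcongP xy /gcongP yz; apply/gcongP; exact: Ct xy yz.
Qed.

Canonical gcong_equiv := EquivRel gcong gcong_refl gcong_sym gcong_trans.

Definition quot_sg : Type := {eq_quot gcong_equiv}.

HB.instance Definition _ := Choice.on quot_sg.
HB.instance Definition _ := EqQuotient.on quot_sg.

Definition quot_mul (x y : quot_sg) : quot_sg :=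
  \pi_quot_sg (repr x * repr y).

Lemma pi_eq (x y : T) :
  (\pi_quot_sg x = \pi_quot_sg y) <-> generated_cong R x y.
Proof.
by split=> [/eqmodP/gcongP//|xy]; apply/eqmodP/gcongP.
Qed.

Lemma pi_mul (x y : T) :
  quot_mul (\pi_quot_sg x) (\pi_quot_sg y) = \pi_quot_sg (x * y).
Proof.
have [_ _ Ct Cl Cr] := generated_congP.
have reprR z : generated_cong R (repr (\pi_quot_sg z)) z.
  by apply/pi_eq; rewrite reprK.
by apply/pi_eq; exact: Ct (Cr _ _ _ (reprR x)) (Cl x _ _ (reprR y)).
Qed.

Fact quot_mulA : associative quot_mul.
Proof.
elim/quotW=> x; elim/quotW=> y; elim/quotW=> z.
by rewrite (pi_mul y z) (pi_mul x y) !pi_mul mulgA.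
Qed.

HB.instance Definition _ := isSemigroup.Build quot_sg quot_mulA.
End Quotient.

Section ActionPair.
Variables (M : monoidType) (U S : mulgClosed M).
Variable phi : left_action (sub_sg S) U^1.

Definition plus (s : sub_sg S) : U^1 := phi s 1.

Definition action_pair : Prop :=
  (forall (s : sub_sg S) (u : U^1), val s * val u = val (phi s u) * val s) /\
  (forall (u v : U^1) (s t : sub_sg S),
     val u * val s = val v * val t -> u * plus s = v * plus t).

Definition plus_sg : set U^1 := generated_sg (range plus).

Definition kappa (s t : sub_sg S) : Prop :=
  exists p q : U^1,
    [/\ plus_sg p, plus_sg q & val p * val s = val q * val t].

Definition sigma : sub_sg S -> sub_sg S -> Prop := generated_cong kappa.

Definition Smod_sigma : semigroupType := quot_sg kappa.

Definition hat (s : sub_sg S) : Smod_sigma := \pi_(quot_sg kappa) s.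

Definition proper_pair : Prop :=
  action_pair /\
  (forall (u v : U^1) (s t : sub_sg S),
     val u * val s = val v * val t <-> u * plus s = v * plus t /\ sigma s t).

End ActionPair.

Definition proper_monoid (M : monoidType) (U S : umagmaClosed M)
    (phi : left_action (sub_sg S) U^1) : Prop :=
  proper_pair phi /\
  (forall m : M, exists (u : sub_sg U) (s : sub_sg S), m = val u * val s).

Definition isomorphism_on (G H : semigroupType) (A : set G) (B : set H)
    (f : G -> H) : Prop :=
  [/\ mulg_closed (mem A), mulg_closed (mem B),
      {in A &, {morph f : x y / x * y}} & set_bij A B f].

(* Main.v *)
Require Import Defs.
From HB Require Import structures.
From mathcomp Require Import all_boot all_classical.

(** Properness makes the pair (u s^+, hat s) depend only on the element u s, and
    makes m = u s |-> (u s^+, hat s) injective.  The product of two such pairs is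
      (u s^+, hat s)(v t^+, hat t) = (u . phi s v . (s t)^+, hat (s t)),
    which would be a semidirect product if S / sigma acted on U.  In
    general it does not, but it acts partially, and only on the right end of a product: if y is fixed
    on the right by both s^+ and t^+, where s sigma t, then y . phi s u =
    y . phi t u ([act_sigma]).

    So each u in U is represented, at every x in S / sigma, by the partial
    transformation y |-> y . phi s u, where hat s = x and y s^+ = y: the right
    translation by the would-be image of u under x.  These assemble into a
    function [translation u] on S / sigma with values in partial transformations
    of U, and S / sigma acts totally on such functions by shifting the argument,
    (t h)(x) = h(x t).  At x = hat 1 the transformation is right translation by
    u, so u is recovered as the image of 1.  The two identities that turn
    m |-> (translation (u s^+), hat s) into a morphism are that translation is
    multiplicative ([translationM]) and
      translation (phi s u) = translation s^+ . (hat s acting on translation u)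
    ([translation_act]), the latter expressing phi s u = s^+ . phi s u.

    All partial transformations of U are too many to form a left-regular band.
    The ones to keep are those moving y to some z = y c and fixing every z w, that
    is, fixing the whole right ideal of each of their values.  They form a
    submonoid in which h h = h and h k h = h k for formal reasons
    ([regular_family_lrb]); left regularity of U is what puts the translations
    in it ([translation_regular]). *)

Set Implicit Arguments.
Unset Strict Implicit.
Unset Printing Implicit Defensive.

Local Open Scope classical_set_scope.
Local Open Scope group_scope.

(** * Left-regular bands of partial transformations *)

Section RegularFamilies.
Variables (X : Type) (E : monoidType).

(** Right translation by an element of a left-regular band E is the model: it
    sends y to y * c, and y * c * w is unchanged by a second multiplication by c
    on the right. *)
Definition regular_partial (h : E -> option E) : Prop :=
  forall y z, h y = Some z ->
    (exists c, z = y * c) /\ forall w, h (z * w) = Some (z * w).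

Definition regular_family : Type :=
  {h : X -> E -> option E | forall x, regular_partial (h x)}.

HB.instance Definition _ := gen_eqMixin regular_family.
HB.instance Definition _ := gen_choiceMixin regular_family.

Definition family_one_fun (x : X) : E -> option E := Some.

(** Composition in the order of right actions: h is applied before k, so that
    right translations compose in the order of their translating elements. *)
Definition family_mul_fun (h k : X -> E -> option E) (x : X) (y : E) :=
  obind (k x) (h x y).

Fact family_one_subproof x : regular_partial (family_one_fun x).
Proof. by move=> y _ [<-]; split=> //; exists 1; rewrite mulg1. Qed.

Fact family_mul_subproof (h k : regular_family) x :
  regular_partial (family_mul_fun (sval h) (sval k) x).
Proof.
case: h k => h hP [k kP] y z; rewrite /family_mul_fun /=.
case hy: (h x y) => [y'|//] /= kz.
have [[c Dy'] hfix] := hP x y y' hy; have [[d Dz] kfix] := kP x y' z kz.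
split=> [|w]; first by exists (c * d); rewrite Dz Dy' mulgA.
by rewrite {1}Dz -mulgA hfix /= mulgA -Dz kfix.
Qed.

Definition family_one : regular_family := exist _ _ (@family_one_subproof).
Definition family_mul (h k : regular_family) : regular_family :=
  exist _ _ (@family_mul_subproof h k).

Lemma regular_family_ext (h k : regular_family) :
  (forall x y, sval h x y = sval k x y) -> h = k.
Proof.
case: h k => h hP [k kP] /= hk.
have {hk} eq_hk : h = k by apply/funext=> x; apply/funext.
by case: k / eq_hk kP => kP; congr exist; apply: Prop_irrelevance.
Qed.

Fact family_mulA : associative family_mul.
Proof.
move=> h k l; apply: regular_family_ext => x y /=.
by rewrite /family_mul_fun /=; case: (sval h x y).
Qed.

Fact family_1mul : left_id family_one family_mul.
Proof. by move=> h; apply: regular_family_ext. Qed.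

Fact family_mul1 : right_id family_one family_mul.
Proof.
move=> h; apply: regular_family_ext => x y /=.
by rewrite /family_mul_fun; case: (sval h x y).
Qed.

HB.instance Definition _ :=
  isMonoid.Build regular_family family_mulA family_1mul family_mul1.

Lemma family_mulE (h k : regular_family) x y :
  sval (h * k) x y = obind (sval k x) (sval h x y).
Proof. by []. Qed.

(** Every value of h * k is a right multiple of a value of h, hence is fixed by
    any further application of h; this gives both band identities. *)
Lemma regular_family_lrb : left_regular_band regular_family.
Proof.
split=> [h|h k]; apply: regular_family_ext => x y; rewrite !family_mulE.
  case hy: (sval h x y) => [z|//] /=.
  by have [_ /(_ 1)] := svalP h x y z hy; rewrite mulg1.
case hy: (sval h x y) => [z|//] /=.
case kz: (sval k x z) => [z'|//] /=.
have [_ hfix] := svalP h x y z hy; have [[c ->] _] := svalP k x z z' kz.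
exact: hfix.
Qed.

End RegularFamilies.

Section Shift.
Variables (T : semigroupType) (E : monoidType).

(** This is a left action because T multiplies the argument on the right. *)
Definition shift (t : T) (h : regular_family T E) : regular_family T E :=
  exist (fun k => forall x, regular_partial (k x))
    (fun x => sval h (x * t)) (fun x => @svalP _ _ h (x * t)).

Fact shiftA s t h : shift s (shift t h) = shift (s * t) h.
Proof. by apply: regular_family_ext => x y /=; rewrite mulgA. Qed.

Fact shiftM s h k : shift s (h * k) = shift s h * shift s k.
Proof. exact: regular_family_ext. Qed.

Definition shift_action : left_action T (regular_family T E) :=
  LeftAction shiftA shiftM.

End Shift.

(** * The translations attached to a proper action pair *)

Section ProperPair.
Variables (M : monoidType) (U S : umagmaClosed M).
Variable phi : left_action (sub_sg S) U^1.
Hypothesis properUS : proper_pair phi.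
Hypothesis bandU : left_regular_band U^1.

Implicit Types (u v y z : U^1) (s t : sub_sg S) (x : Smod_sigma phi).

Let slide s u : val s * val u = val (phi s u) * val s.
Proof. by have [[]] := properUS. Qed.

Lemma act_plus s u : phi s u * plus phi s = phi s u.
Proof. by rewrite -actM mulg1. Qed.

Lemma plus_act s u : plus phi s * phi s u = phi s u.
Proof. by rewrite -actM mul1g. Qed.

Lemma plus_mul s t : plus phi (s * t) = phi s (plus phi t).
Proof. by rewrite /plus actA. Qed.

Lemma act1 u : phi 1 u = u.
Proof. by apply: val_inj; have := slide 1 u; rewrite mul1g mulg1. Qed.

Lemma hat_eq s t : hat phi s = hat phi t <-> sigma phi s t.
Proof. exact: pi_eq. Qed.

Lemma hatM s t : hat phi (s * t) = hat phi s * hat phi t.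
Proof. exact/esym/pi_mul. Qed.

(** The hypotheses on y give y s = y t by properness, hence y s u = y t u.
    Sliding u to the left of s and of t turns this into
    (y . phi s u) s = (y . phi t u) t, and (A2) cancels s and t at the cost of
    the factors s^+ and t^+, which phi s u and phi t u absorb. *)
Lemma act_sigma s t y u : sigma phi s t ->
  y * plus phi s = y -> y * plus phi t = y -> y * phi s u = y * phi t u.
Proof.
move=> st ys yt; have [[_ A2] proper] := properUS.
have yst: val y * val s = val y * val t by apply/proper; rewrite ys yt.
rewrite -(act_plus s) -(act_plus t) !mulgA; apply: A2.
by rewrite !valM -!mulgA -!slide !mulgA yst.
Qed.

(** The right translation by the image of u under a representative s of x,
    restricted to those y on which, by [act_sigma], the choice of s among
    the representatives with y s^+ = y is immaterial. *)
Definition translation_fun u x y : option U^1 :=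
  if pselect (exists2 s, hat phi s = x & y * plus phi s = y) is left ex
  then Some (y * phi (s2val (cid2 ex)) u) else None.

Lemma translation_fun_hat u s y :
  y * plus phi s = y -> translation_fun u (hat phi s) y = Some (y * phi s u).
Proof.
rewrite /translation_fun => ys; case: pselect => [ex|[]]; last by exists s.
case: cid2 => t /= /hat_eq ts yt; congr Some; exact: act_sigma.
Qed.

Lemma translation_fun_some u x y z : translation_fun u x y = Some z ->
  exists s, [/\ hat phi s = x, y * plus phi s = y & z = y * phi s u].
Proof.
rewrite /translation_fun; case: pselect => [ex|//].
by case: cid2 => s /= sx ys [<-]; exists s.
Qed.

Lemma translation_domain x y :
  (exists2 s, hat phi s = x & y * plus phi s = y) \/
  (forall u, translation_fun u x y = None).
Proof.
have [dom|ndom] := pselect (exists2 s, hat phi s = x & y * plus phi s = y).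
  by left.
by right=> u; rewrite /translation_fun; case: pselect.
Qed.

(** Left regularity of U is used twice: y . phi s u . w stays in the domain
    because y already ends in s^+, and it is fixed because phi s u already
    occurs in it. *)
Lemma translation_regular u x : regular_partial (translation_fun u x).
Proof.
have [UU UUU] := bandU.
move=> y z /translation_fun_some[s [<- ys ->]].
split=> [|w]; first by exists (phi s u).
rewrite translation_fun_hat; first by rewrite -!mulgA [_ * (w * _)]mulgA UUU.
have /(congr1 ( *%g y)) := UUU (plus phi s) (phi s u * w).
by rewrite !mulgA ys.
Qed.

Definition translation u : regular_family (Smod_sigma phi) U^1 :=
  exist _ (translation_fun u) (@translation_regular u).

Lemma translationM u v : translation (u * v) = translation u * translation v.
Proof.
apply: regular_family_ext => x y; rewrite family_mulE /=.
have [[s <- ys]|undef] := translation_domain x y; last by rewrite !undef.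
rewrite !translation_fun_hat //= translation_fun_hat; last first.
  by rewrite -mulgA act_plus.
by rewrite actM mulgA.
Qed.

(** At x = hat r, both sides translate by phi (r * s) u those y with y r^+ = y:
    on the right, the factor translation s^+ multiplies y by phi r s^+ = (r s)^+,
    which is what brings it into the domain of the transformation at x * hat s. *)
Lemma translation_act s u : translation (phi s u) =
  translation (plus phi s) * shift (hat phi s) (translation u).
Proof.
apply: regular_family_ext => x y; rewrite family_mulE /=.
have [[r <- yr]|undef] := translation_domain x y; last by rewrite !undef.
rewrite !translation_fun_hat //= -hatM -plus_mul translation_fun_hat.
  by rewrite actA -mulgA plus_act.
by have [idemU _] := bandU; rewrite -mulgA idemU.
Qed.

(** At hat 1, translation w multiplies by w on the right, so 1 is sent to w. *)
Lemma translation_inj : injective translation.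
Proof.
move=> u v uv.
have at1 w : sval (translation w) (hat phi 1) 1 = Some w.
  by rewrite /= translation_fun_hat ?act1 ?mul1g // [LHS]act1.
by apply: Some_inj; rewrite -!at1 uv.
Qed.

Definition embed_pair u s : sdprod (shift_action (Smod_sigma phi) U^1) :=
  (translation (u * plus phi s), hat phi s).

(** One direction says that the embedding is well defined on products u s, the
    other that it is injective. *)
Lemma embed_pair_eq u s v t :
  embed_pair u s = embed_pair v t <-> val u * val s = val v * val t.
Proof.
have [_ proper] := properUS; rewrite proper -hat_eq.
split=> [/pair_equal_spec[/translation_inj uv st]|[uv st]] //.
by rewrite /embed_pair uv st.
Qed.

Lemma embed_pairM u s v t :
  embed_pair u s * embed_pair v t = embed_pair (u * phi s v) (s * t).
Proof.
congr pair; last exact/esym/hatM.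
rewrite /= translationM -mulgA -translation_act -translationM; congr translation.
by rewrite -mulgA plus_mul actM.
Qed.

Lemma val_pairM u s v t :
  (val u * val s) * (val v * val t) = val (u * phi s v) * val (s * t).
Proof. by rewrite !valM -!mulgA [val s * _]mulgA slide -!mulgA. Qed.

End ProperPair.

(** * The embedding *)

Lemma mem_adjoin1 (M : monoidType) (U : umagmaClosed M) m :
  (m \in adjoin1 U) = (m \in U).
Proof.
by rewrite unfold_in /adjoin1; case: eqP => // ->; rewrite gpred1.
Qed.

Lemma adjoin1_lrb (M : monoidType) (U : umagmaClosed M) :
  left_regular_band (sub_sg U) -> left_regular_band U^1.
Proof.
pose restr (u : U^1) : sub_sg U :=
  exist _ (val u) (etrans (esym (mem_adjoin1 U (val u))) (valP u)).
move=> [idemU lregU]; split=> [u|u v]; apply: val_inj; rewrite !valM.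
  by have /(congr1 val) := idemU (restr u); rewrite valM.
by have /(congr1 val) := lregU (restr u) (restr v); rewrite !valM.
Qed.

Theorem theorem5p102 (M : monoidType) (U S : umagmaClosed M)
    (phi : left_action (sub_sg S) U^1)
    (hM : proper_monoid phi) (hU : left_regular_band (sub_sg U)) :
  exists (UL : monoidType) (alpha : left_action (Smod_sigma phi) UL)
         (psi : {multiplicative M -> sdprod alpha}),
    [/\ injective psi,
        left_regular_band UL
      & exists U' : set UL,
          (exists f : M -> UL, isomorphism_on [set` U] U' f) /\
          isomorphism_on [set` U]
            (U' `*` [set hat phi 1] : set (sdprod alpha)) psi].
Proof.
have [properUS factorM] := hM; have bandU := adjoin1_lrb hU.
pose alpha := shift_action (Smod_sigma phi) U^1.
pose E := embed_pair properUS bandU.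
have factor m : exists us : U^1 * sub_sg S, m = val us.1 * val us.2.
  have [u [s ->]] := factorM m.
  have Uu : val u \in adjoin1 U by rewrite mem_adjoin1; exact: (valP u).
  by exists (exist _ (val u) Uu : U^1, s).
have [dec decE] := choice factor.
(* By embed_pair_eq, psi does not depend on the factorizations chosen by dec. *)
pose psi m := E (dec m).1 (dec m).2.
have psiE u s : psi (val u * val s) = E u s by apply/embed_pair_eq/esym/decE.
have psiM : {morph psi : m n / m * n}.
  move=> m n; rewrite [m]decE [n]decE (val_pairM properUS) !psiE.
  exact/esym/embed_pairM.
have psi_inj : injective psi.
  by move=> m n /embed_pair_eq; rewrite -!decE.
pose psi_morph := HB.pack_for {multiplicative M -> sdprod alpha} psi
  (isMultiplicative.Build _ _ psi psiM).
exists (regular_family (Smod_sigma phi) U^1), alpha, psi_morph.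
split=> //; first exact: regular_family_lrb.
have U_val m : m \in U -> exists u : U^1, val u = m.
  by move=> Um; rewrite -mem_adjoin1 in Um; exists (exist _ m Um).
pose f m := (psi m).1.
have psi_U m : m \in U -> psi m = (f m, hat phi 1).
  by move=> /U_val[u <-]; rewrite /f -[val u]mulg1 (psiE u 1).
have fE (u : U^1) : f (val u) = translation properUS bandU u.
  by rewrite /f -[val u]mulg1 (psiE u 1) /= [plus phi 1](act1 properUS) mulg1.
have fM : {in U &, {morph f : m n / m * n}}.
  by move=> _ _ /U_val[u <-] /U_val[v <-]; rewrite -valM !fE translationM.
have f_inj : {in U &, injective f}.
  move=> m n Um Un fmn; apply: psi_inj.
  by rewrite !psi_U // fmn.
have closedU : mulg_closed (mem [set` U]).
  by move=> m n /set_mem Um /set_mem Un; apply/mem_set; exact: gpredM.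
have imageM (V : magmaType) (h : M -> V) :
    {in U &, {morph h : m n / m * n}} -> mulg_closed (mem (h @` [set` U])).
  move=> hM' _ _ /set_mem[m Um <-] /set_mem[n Un <-].
  by rewrite -hM' //; apply/mem_set; exists (m * n) => //; exact: gpredM.
have image_psi : (f @` [set` U] `*` [set hat phi 1] : set (sdprod alpha)) =
    psi @` [set` U].
  apply/seteqP; split=> [[_ _] [/= [m Um <-] ->]|_ [m Um <-]].
    by exists m => //; rewrite psi_U.
  by rewrite psi_U //; split=> //; exists m.
exists (f @` [set` U]); split.
  exists f; split=> //; first exact: imageM.
    by move=> m n /set_mem Um /set_mem Un; exact: fM.
  by split=> // m n /set_mem Um /set_mem Un; exact: f_inj.
rewrite image_psi; split=> //.
- by apply: imageM => m n _ _; exact: psiM.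
- by split=> // m n _ _; exact: psi_inj.
Qed.
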